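(* Suppose $G$ is a simple graph with $n$ vertices and $k>1$ connected components. If $\Phi=\{\phi_i\}_{i\in[n]}$ is a $G(n,n-k)$-frame for $\mathbb{C}^{n-k}$ with frame operator $S_\Phi$, then there exists an alternate dual frame of $\Phi$ (a dual frame different from the canonical dual frame $S_\Phi^{-1}\Phi$) which is a spectrally optimal dual frame of $\Phi$ for $2$-erasures.
   Context: Write $[n]=\{1,\dots,n\}$; inner products on $\mathbb{C}^d$ are standard and linear in the first argument. A finite sequence $\Phi=\{\phi_i\}_{i\in[n]}$ in $\mathbb{C}^d$ is a frame for $\mathbb{C}^d$ if there are constants $0<A\le B$ with $A\|f\|^2\le\sum_{i\in[n]}|\langle f,\phi_i\rangle|^2\le B\|f\|^2$ for all $f\in\mathbb{C}^d$. Its frame operator is $S_\Phi f=\sum_{i\in[n]}\langle f,\phi_i\rangle\phi_i$ (invertible). A frame $\Psi=\{\psi_i\}_{i\in[n]}$ of $\mathbb{C}^d$ is a dual frame of $\Phi$ if $f=\sum_{i\in[n]}\langle f,\phi_i\rangle\psi_i=\sum_{i\in[n]}\langle f,\psi_i\rangle\phi_i$ for all $f\in\mathbb{C}^d$; $D_\Phi$ denotes the set of dual frames of $\Phi$. The canonical dual frame of $\Phi$ is $S_\Phi^{-1}\Phi:=\{S_\Phi^{-1}\phi_i\}_{i\in[n]}\in D_\Phi$; all other dual frames are called alternate dual frames. Spectral optimality: for $\Psi\in D_\Phi$ and $\Lambda\subset[n]$, the error operator is $E_{\Phi,\Psi,\Lambda}(f)=\sum_{i\in\Lambda}\langle f,\phi_i\rangle\psi_i$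 on $\mathbb{C}^d$, and for $1\le r<n$, $\rho^{(r)}_{\Phi,\Psi}:=\max\{\rho(E_{\Phi,\Psi,\Lambda}):\Lambda\subset[n],\ |\Lambda|=r\}$, where $\rho(\cdot)$ is the spectral radius. Put $\rho^{(r)}_\Phi:=\min\{\rho^{(r)}_{\Phi,\widetilde\Psi}:\widetilde\Psi\in D_\Phi\}$. $\Psi\in D_\Phi$ is a spectrally optimal dual frame of $\Phi$ for $1$-erasure if $\rho^{(1)}_{\Phi,\Psi}=\rho^{(1)}_\Phi$. $\Psi$ is a spectrally optimal dual frame of $\Phi$ for $2$-erasures if it is a spectrally optimal dual frame for $1$-erasure and $\rho^{(2)}_{\Phi,\Psi}=\rho^{(2)}_\Phi$ (the minimum being over all of $D_\Phi$). Graph frames: for a simple graph $G$ with vertices $v_1,\dots,v_n$, the Laplacian matrix is $L(G)=D(G)-A(G)$ (degree matrix minus adjacency matrix). A frame $\Phi=\{\phi_i\}_{i\in[n]}$ for $\mathbb{C}^m$ is a $G(n,m)$-frame (frame generated by $G$) if its Gramian matrix $\mathcal{G}_\Phi=[\langle\phi_j,\phi_i\rangle]_{i,j\in[n]}$ equals $L(G)$. *)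

(* Defs.v *)
From mathcomp Require Import all_boot all_order all_algebra.
From mathcomp Require Import spectral complex.
From mathcomp Require Import classical_sets reals.

Set Implicit Arguments.
Unset Strict Implicit.
Unset Printing Implicit Defensive.

Import Order.TTheory GRing.Theory Num.Theory.

Local Open Scope ring_scope.
Local Open Scope complex_scope.
Local Open Scope classical_set_scope.

(* The field of complex numbers is R[i] with R : realType, and vectors of C^d
   are row vectors, so that the matrix of an operator T is lin1_mx T, which acts
   by right multiplication: T f = f *m lin1_mx T.  The inner product is the
   library's dotmx u v = \sum_j u_j * (v_j)^*, linear in u. *)

Section Frames.
Variables (R : realType) (n d : nat).
Local Notation C := R[i].
Local Notation V := 'rV[C]_d.
Implicit Types (Phi Psi : {ffun 'I_n -> V}) (L : {set 'I_n}) (f : V).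

Definition is_frame Phi : Prop :=
  exists A B : R, [/\ 0 < A, A <= B &
    forall f, A%:C * dotmx f f <= \sum_(i < n) `|dotmx f (Phi i)| ^+ 2
              /\ \sum_(i < n) `|dotmx f (Phi i)| ^+ 2 <= B%:C * dotmx f f].

Definition frame_op Phi (f : V) : V :=
  \sum_(i < n) dotmx f (Phi i) *: Phi i.

Definition is_dual_frame Phi Psi : Prop :=
  is_frame Psi /\
  forall f, f = \sum_(i < n) dotmx f (Phi i) *: Psi i
            /\ f = \sum_(i < n) dotmx f (Psi i) *: Phi i.

Definition canonical_dual Phi : {ffun 'I_n -> V} :=
  [ffun i => Phi i *m invmx (lin1_mx (frame_op Phi))].

Definition is_alternate_dual Phi Psi : Prop :=
  is_dual_frame Phi Psi /\ Psi != canonical_dual Phi.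

Definition gramian Phi : 'M[C]_n := \matrix_(i, j) dotmx (Phi j) (Phi i).

Definition error_op Phi Psi L (f : V) : V :=
  \sum_(i in L) dotmx f (Phi i) *: Psi i.

Definition spectral_radius (T : V -> V) : R :=
  sup [set complex.Re `|a| | a in [set a : C | eigenvalue (lin1_mx T) a]].

(* Spectral radii are nonnegative, so the default value 0 of the iterated
   maximum does not affect the result. *)
Definition rho (r : nat) Phi Psi : R :=
  \big[Num.max/0]_(L : {set 'I_n} | #|L| == r)
    spectral_radius (error_op Phi Psi L).

(* m is the minimum, over all dual frames of Phi, of rho r Phi. *)
Definition is_min_rho (r : nat) Phi (m : R) : Prop :=
  let values := [set rho r Phi Psi | Psi in [set Psi | is_dual_frame Phi Psi]] in
  values m /\ lbound values m.

Definition spectrally_optimal1 Phi Psi : Prop :=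
  is_dual_frame Phi Psi /\ is_min_rho 1 Phi (rho 1 Phi Psi).

Definition spectrally_optimal2 Phi Psi : Prop :=
  spectrally_optimal1 Phi Psi /\ is_min_rho 2 Phi (rho 2 Phi Psi).

End Frames.

Section Graphs.
Variables (n : nat) (e : rel 'I_n).

Definition simple_graph : Prop := symmetric e /\ irreflexive e.

Definition num_components : nat := n_comp e 'I_n.

Definition laplacian (K : pzRingType) : 'M[K]_n :=
  diag_mx (\row_i #|[set j | e i j]%SET|%:R) - \matrix_(i, j) (e i j)%:R.

End Graphs.

Definition graph_frame (R : realType) (n m : nat) (e : rel 'I_n)
    (Phi : {ffun 'I_n -> 'rV[R[i]]_m}) : Prop :=
  is_frame Phi /\ gramian Phi = laplacian e R[i].

(* Main.v *)
(* Write M for the cross-Gramian <psi_i, phi_j> of a dual Psi of Phi.  Since the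
   Gramian of Phi is the Laplacian, the columns of I - M lie in its kernel, i.e.
   they are constant on connected components, and the phi_j sum to zero over
   each component.  Hence the trace of M over a component of size m is m - 1, so
   that some |M_ii| there is at least 1 - 1/m; and if i and j are distinct vertices
   of a component, the error operator of {i, j} fixes psi_i - psi_j, so that the
   2-erasure radius of every dual is at least 1.  For the canonical dual, M is
   the identity minus the averaging over components, and both bounds are
   attained.  Adding one fixed S^-1 phi_i0 <> 0 to the canonical dual vectors of a
   component other than that of i0 keeps M block triangular with the same diagonal
   blocks, hence changes none of the spectral radii for 1 and 2 erasures. *)
Require Import Defs.
From mathcomp Require Import all_boot all_order all_algebra.
From mathcomp Require Import complex reals.
From mathcomp Require Import sesquilinear spectral classical_sets.
From mathcomp Require Import ring.

Set Implicit Arguments.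
Unset Strict Implicit.
Unset Printing Implicit Defensive.

Import Order.TTheory GRing.Theory Num.Theory.

Section GraphFrames.
Local Open Scope ring_scope.
Local Open Scope complex_scope.
Local Notation "''[' u , v ]" := (dotmx u v) : ring_scope.

(** * Rules for the inner product *)

Lemma dotC (C : numClosedFieldType) d (u v : 'rV[C]_d) : '[u, v] = Num.conj '[v, u].
Proof. by rewrite (hermC (@dotmx C d)) expr0 mul1r. Qed.

Lemma dot0l (C : numClosedFieldType) d (v : 'rV[C]_d) : '[0, v] = 0.
Proof. exact: (linear0l (@dotmx C d)). Qed.

Lemma dotDl (C : numClosedFieldType) d (u v w : 'rV[C]_d) :
  '[u + v, w] = '[u, w] + '[v, w].
Proof. exact: (linearDl (@dotmx C d)). Qed.

Lemma dotBl (C : numClosedFieldType) d (u v w : 'rV[C]_d) :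
  '[u - v, w] = '[u, w] - '[v, w].
Proof. exact: (linearBl (@dotmx C d)). Qed.

Lemma dotZl (C : numClosedFieldType) d a (u v : 'rV[C]_d) :
  '[a *: u, v] = a * '[u, v].
Proof. by rewrite !dotmxE -scalemxAl mxE. Qed.

Lemma dot_suml (C : numClosedFieldType) d (I : finType) (P : pred I)
    (x : I -> 'rV[C]_d) v :
  '[\sum_(i | P i) x i, v] = \sum_(i | P i) '[x i, v].
Proof. exact: (linear_sumlz (@dotmx C d)). Qed.

Lemma dot_sumr (C : numClosedFieldType) d (I : finType) (P : pred I)
    (x : I -> 'rV[C]_d) v :
  '[v, \sum_(i | P i) x i] = \sum_(i | P i) '[v, x i].
Proof. exact: (linear_sumr (@dotmx C d)). Qed.

Lemma dot_combl (C : numClosedFieldType) d (I : finType) (P : pred I)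
    (a : I -> C) (x : I -> 'rV[C]_d) v :
  '[\sum_(i | P i) a i *: x i, v] = \sum_(i | P i) a i * '[x i, v].
Proof. by rewrite dot_suml; apply: eq_bigr => i _; rewrite dotZl. Qed.

Lemma dot_inj (C : numClosedFieldType) d (u v : 'rV[C]_d) :
  (forall w, '[u, w] = '[v, w]) -> u = v.
Proof.
move=> uv; apply/eqP; rewrite -subr_eq0 -(dnorm_eq0 (@dotmx C d)).
by rewrite /= dotBl uv subrr.
Qed.

(** Exchanging the two families gives the adjoint. Hence either reconstruction formula implies the
    other and, for [Psi = Phi], the frame operator is self-adjoint. *)
Lemma dot_analysis_adjoint (C : numClosedFieldType) n d
    (Phi Psi : 'I_n -> 'rV[C]_d) u v :
  '[\sum_i '[u, Phi i] *: Psi i, v] = '[u, \sum_i '[v, Psi i] *: Phi i].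
Proof.
rewrite dot_combl [RHS]dotC dot_combl rmorph_sum; apply: eq_bigr => i _.
by rewrite rmorphM mulrC; congr (_ * _); exact: dotC.
Qed.

(** * Eigenvalues of 2 x 2 blocks and scalar inequalities *)

Lemma subr_swap (V : zmodType) (a b x y : V) : a - x = b - y -> x - y = a - b.
Proof. by move=> axby; rewrite -[x](subKr a) axby opprB addrA addrAC addrK. Qed.

(** Here [(x, y)] is a row eigenvector of a triangular matrix with diagonal [p], [u]. *)
Lemma eigenvalue_triangular_2x2 (F : fieldType) (p q s u a x y : F) :
  x * p + y * q = a * x -> x * s + y * u = a * y -> (x != 0) || (y != 0) ->
  s = 0 \/ q = 0 -> a = p \/ a = u.
Proof.
move=> Ei Ej xy; case=> z0; [move: Ej | move: Ei]; rewrite z0 mulr0 ?add0r ?addr0 mulrC => E.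
  have [y0|y0] := eqVneq y 0; last by right; rewrite (mulIf y0 E).
  move: xy Ei; rewrite y0 eqxx orbF mul0r addr0 mulrC => x0 /(mulIf x0).
  by left.
have [x0|x0] := eqVneq x 0; last by left; rewrite (mulIf x0 E).
move: xy Ej; rewrite x0 eqxx mul0r add0r mulrC => y0 /(mulIf y0).
by right.
Qed.

(** The matrix is [I - t J] with [J] all ones: it fixes [y - x], and it scales vectors with equal
    entries by [1 - 2t]. *)
Lemma eigenvalue_rank1_2x2 (F : fieldType) (t a x y : F) :
  x * (1 - t) + y * - t = a * x -> x * - t + y * (1 - t) = a * y ->
  (x != 0) || (y != 0) -> a = 1 \/ a = (1 - t) - t.
Proof.
move=> Ei Ej xy; have [yx|yx] := eqVneq y x.
  right; move: Ei xy; rewrite yx orbb -mulrDr mulrC => Ei x0.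
  by rewrite (mulIf x0 Ei).
left; have yx0 : y - x != 0 by rewrite subr_eq0.
apply: (mulIf yx0); rewrite mul1r mulrBr -Ei -Ej; ring.
Qed.

Lemma ler_invM_of_sqr (F : numFieldType) (b t x y : F) :
  0 < b -> 0 < t -> 0 <= x -> t ^+ 2 <= x * y -> y <= b * t -> b^-1 * t <= x.
Proof.
move=> b0 t0 x0 txy ybt; rewrite ler_pdivrMl // -(ler_pM2r t0) -expr2.
by apply: le_trans txy _; rewrite -mulrA mulrCA ler_wpM2l.
Qed.

Lemma sum_CauchySchwarz (C : numClosedFieldType) n (x y : 'I_n -> C) :
  `|\sum_i x i * Num.conj (y i)| ^+ 2 <=
  (\sum_i `|x i| ^+ 2) * (\sum_i `|y i| ^+ 2).
Proof.
have E (u v : 'I_n -> C) :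
    \sum_i u i * Num.conj (v i) = '[\row_i u i, \row_i v i].
  by rewrite dotmxE mxE; apply: eq_bigr => i _; rewrite !mxE.
have N (u : 'I_n -> C) : \sum_i `|u i| ^+ 2 = '[\row_i u i, \row_i u i].
  by rewrite -E; apply: eq_bigr => i _; rewrite normCK.
rewrite E !N; exact: (CauchySchwarz (@dotmx C n) _ _).1.
Qed.

(** * Matrices of the operators and bounds on spectral radii *)

Lemma lin1_mxE (F : fieldType) d (T : 'rV[F]_d -> 'rV[F]_d) (M : 'M[F]_d) :
  (forall f, T f = f *m M) -> lin1_mx T = M.
Proof.
by move=> TM; apply/row_matrixP => i; apply/rowP => j; rewrite !mxE TM -rowE mxE.
Qed.

Lemma error_opE (R : realType) n d (Phi Psi : {ffun 'I_n -> 'rV[R[i]]_d}) L f :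
  error_op Phi Psi L f = f *m lin1_mx (error_op Phi Psi L).
Proof.
suff TM g : error_op Phi Psi L g =
    g *m \sum_(i in L) (map_mx Num.conj (Phi i)^T *m Psi i) by rewrite (lin1_mxE TM) TM.
rewrite mulmx_sumr; apply: eq_bigr => i _.
by rewrite mulmxA dotmxE [g *m _]mx11_scalar mul_scalar_mx mxE eqxx mulr1n.
Qed.

Lemma error_opT (R : realType) n d (Phi : {ffun 'I_n -> 'rV[R[i]]_d}) f :
  error_op Phi Phi [set: 'I_n]%SET f = frame_op Phi f.
Proof. by apply: eq_bigl => i; rewrite inE. Qed.

Lemma frame_opE (R : realType) n d (Phi : {ffun 'I_n -> 'rV[R[i]]_d}) f :
  frame_op Phi f = f *m lin1_mx (frame_op Phi).
Proof.
by rewrite (@lin1_mxE _ _ _ _ (fun g => etrans (esym (error_opT Phi g))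
  (error_opE _ _ _ _))) -error_opE error_opT.
Qed.

Lemma error_eigenP (R : realType) n d (Phi Psi : {ffun 'I_n -> 'rV[R[i]]_d}) L a :
  reflect (exists2 v, error_op Phi Psi L v = a *: v & v != 0)
          (eigenvalue (lin1_mx (error_op Phi Psi L)) a).
Proof.
by apply: (iffP eigenvalueP) => -[v Tv v0]; exists v; rewrite // -?error_opE // error_opE.
Qed.

Lemma Re_norm (R : realType) (a : R[i]) : `|a| = (complex.Re `|a|)%:C.
Proof. by case: a => x y. Qed.

Lemma ge0_Re (R : realType) (a : R[i]) : 0 <= a -> (complex.Re a)%:C = a.
Proof. by move=> a0; rewrite -{1}(ger0_norm a0) -Re_norm ger0_norm. Qed.

Lemma spectral_radius_le (R : realType) d (T : 'rV[R[i]]_d -> 'rV[R[i]]_d) (c : R) :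
  0 <= c -> (forall a, eigenvalue (lin1_mx T) a -> `|a| <= c%:C) ->
  spectral_radius T <= c.
Proof.
move=> c0 Tc; rewrite /spectral_radius; set A := image _ _.
have ubA : ubound A c.
  by move=> _ [a Ta <-]; have := Tc a Ta; rewrite Re_norm lecR.
(* The spectrum is empty when [d = 0]; [sup] then takes the value 0, hence the hypothesis
   [0 <= c]. *)
have [A0|/set0P A0] := eqVneq A set0; last exact: ge_sup.
by rewrite A0 sup0.
Qed.

(** The characteristic polynomial splits, and each root is bounded by the sum of the moduli of all.
    This makes [sup] a genuine upper bound of the spectrum. *)
Lemma eigenvalue_bounded (R : realType) d (M : 'M[R[i]]_d) :
  exists B : R, forall a, eigenvalue M a -> complex.Re `|a| <= B.
Proof.
have [r pr] := closed_field_poly_normal (char_poly M).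
exists (\sum_(z <- r) complex.Re `|z|) => a.
rewrite eigenvalue_root_char pr (monicP (char_poly_monic M)) scale1r root_prod_XsubC.
have nn (z : R[i]) : 0 <= complex.Re `|z| by rewrite -lecR -Re_norm; exact: normr_ge0.
move=> ar; rewrite (big_rem a ar) lerDl; apply: sumr_ge0 => z _; exact: nn.
Qed.

Lemma spectral_radius_ge (R : realType) d (T : 'rV[R[i]]_d -> 'rV[R[i]]_d) a :
  eigenvalue (lin1_mx T) a -> complex.Re `|a| <= spectral_radius T.
Proof.
move=> Ta; apply: ub_le_sup; last by exists a.
by have [B Bub] := eigenvalue_bounded (lin1_mx T); exists B => _ [b Tb <-]; apply: Bub.
Qed.

(** * Erasure radii, the canonical dual and the construction of dual frames *)

Section FrameTheory.
Variables (R : realType) (n d : nat).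
Implicit Types (Phi Psi : {ffun 'I_n -> 'rV[R[i]]_d}).

Lemma rho_ge r Phi Psi (L : {set 'I_n}) a : #|L| = r ->
  eigenvalue (lin1_mx (error_op Phi Psi L)) a -> `|a| <= (rho r Phi Psi)%:C.
Proof.
move=> Lr La; rewrite Re_norm lecR; apply: bigmax_sup (spectral_radius_ge La).
exact/eqP.
Qed.

Lemma rho_le r Phi Psi (c : R) : 0 <= c ->
  (forall (L : {set 'I_n}) a, #|L| = r ->
    eigenvalue (lin1_mx (error_op Phi Psi L)) a -> `|a| <= c%:C) ->
  rho r Phi Psi <= c.
Proof.
move=> c0 H; apply: bigmax_le => // L /eqP Lr.
by apply: spectral_radius_le => // a; apply: H.
Qed.

Lemma rho_ge0 r Phi Psi : 0 <= rho r Phi Psi.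
Proof. exact: bigmax_ge_id. Qed.

(** The operator of the erasure of [i] has [Psi i] as an eigenvector for this inner product, unless
    the latter is 0. *)
Lemma norm_dot_le_rho1 Phi Psi i : `|'[Psi i, Phi i]| <= (rho 1 Phi Psi)%:C.
Proof.
have [->|nz] := eqVneq '[Psi i, Phi i] 0; first by rewrite normr0 (lecR 0) rho_ge0.
apply: (rho_ge (L := [set i]%SET)); first exact: cards1.
apply/error_eigenP; exists (Psi i); first by rewrite /error_op big_set1.
by apply: contraNneq nz => ->; rewrite dot0l.
Qed.

(** The coefficients of an eigenvector [f] form a row eigenvector of the [L] block of the
    cross-Gramian. This reduces spectra to those of small matrices. *)
Lemma error_op_dot Phi Psi L f a l : error_op Phi Psi L f = a *: f ->
  \sum_(i in L) '[f, Phi i] * '[Psi i, Phi l] = a * '[f, Phi l].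
Proof. by move=> H; rewrite -dot_combl -[X in '[X, _]]/(error_op _ _ _ _) H dotZl. Qed.

Lemma error_op_coef_neq0 Phi Psi L f a : error_op Phi Psi L f = a *: f ->
  f != 0 -> a != 0 -> exists2 i, i \in L & '[f, Phi i] != 0.
Proof.
move=> H f0 a0; apply/exists_inP; apply: contraNT f0.
rewrite negb_exists_in => /forall_inP c0.
have : a *: f == 0.
  by rewrite -H /error_op big1 // => i /c0; rewrite negbK => /eqP->; rewrite scale0r.
by rewrite scaler_eq0 (negPf a0).
Qed.

Lemma rho1_le Phi Psi (c : R) :
  0 <= c -> (forall i, `|'[Psi i, Phi i]| <= c%:C) -> rho 1 Phi Psi <= c.
Proof.
move=> c0 H; apply: rho_le => // L a /eqP/cards1P[i ->] /error_eigenP[f Ef f0].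
have [->|a0] := eqVneq a 0; first by rewrite normr0 (lecR 0).
have [j /set1P-> cj] := error_op_coef_neq0 Ef f0 a0.
have := error_op_dot i Ef; rewrite big_set1 mulrC => /(mulIf cj) <-; exact: H.
Qed.

Lemma is_frame_dot_eq0 Phi f :
  is_frame Phi -> (forall i, '[f, Phi i] = 0) -> f = 0.
Proof.
case=> A [B [A0 _ /(_ f)[lb _]]] f0; apply/eqP.
rewrite -(dnorm_eq0 (@dotmx _ d)) /=.
have := lb; rewrite big1 => [|i _]; last by rewrite f0 normr0 expr0n.
rewrite pmulr_rle0 ?(ltcR 0) // => ff; rewrite eq_le ff; exact: (dnorm_ge0 (@dotmx _ d)).
Qed.

(** If [S f = 0], then [<S f, f>], the sum of the squared moduli of the coefficients of [f],
    vanishes. *)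
Lemma frame_op_unit Phi : is_frame Phi -> lin1_mx (frame_op Phi) \in unitmx.
Proof.
move=> frPhi; rewrite -row_free_unit -kermx_eq0; apply/rowV0P => f /sub_kermxP.
rewrite -frame_opE => Sf0; apply: (is_frame_dot_eq0 frPhi) => i.
have : '[frame_op Phi f, f] = 0 by rewrite Sf0 dot0l.
rewrite dot_combl => /eqP; rewrite psumr_eq0 => [/allP/(_ i)|j _].
  rewrite mem_index_enum [X in _ * X]dotC -normCK => /(_ isT).
  by rewrite sqrf_eq0 normr_eq0 => /eqP.
by rewrite [X in _ * X]dotC -normCK exprn_ge0.
Qed.

Lemma frame_op_canonical_dual Phi i : is_frame Phi ->
  frame_op Phi (canonical_dual Phi i) = Phi i.
Proof. by move=> frPhi; rewrite frame_opE ffunE mulmxKV // frame_op_unit. Qed.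

Lemma canonical_dual_synthesis Phi f : is_frame Phi ->
  f = \sum_i '[f, Phi i] *: canonical_dual Phi i.
Proof.
move=> frPhi; rewrite -[LHS](mulmxK (frame_op_unit frPhi)) -frame_opE mulmx_suml.
by apply: eq_bigr => i _; rewrite ffunE scalemxAl.
Qed.

Lemma canonical_dual_dotC Phi i j : is_frame Phi ->
  '[canonical_dual Phi i, Phi j] = Num.conj '[canonical_dual Phi j, Phi i].
Proof.
move=> frPhi; rewrite -{1}(frame_op_canonical_dual j frPhi).
by rewrite -dot_analysis_adjoint -/(frame_op _ _) frame_op_canonical_dual // dotC.
Qed.

Lemma bessel_bound Psi f :
  \sum_i `|'[f, Psi i]| ^+ 2 <= (\sum_i complex.Re '[Psi i, Psi i])%:C * '[f, f].
Proof.
rewrite rmorph_sum mulr_suml; apply: ler_sum => i _.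
rewrite [X in X * _]ge0_Re; last exact: (dnorm_ge0 (@dotmx _ d)).
rewrite mulrC; exact: (CauchySchwarz (@dotmx _ d) f (Psi i)).1.
Qed.

(** The second formula is the adjoint of the first. The lower frame bound comes from Cauchy-Schwarz
    applied to [<f, f>] written as the pairing of the two coefficient sequences. *)
Lemma is_dual_frame_synthesis Phi Psi : is_frame Phi ->
  (forall f, f = \sum_i '[f, Phi i] *: Psi i) -> is_dual_frame Phi Psi.
Proof.
move=> [A [B [A0 AB frB]]] syn.
have syn' f : f = \sum_i '[f, Psi i] *: Phi i.
  by apply: dot_inj => g; rewrite dot_analysis_adjoint -syn.
split; last by move=> f; split; [exact: syn | exact: syn'].
have B0 : 0 < B by apply: lt_le_trans AB.
pose K := \sum_i complex.Re '[Psi i, Psi i].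
have K0 : 0 <= K.
  apply: sumr_ge0 => i _.
  by have := dnorm_ge0 (@dotmx _ d) (Psi i); rewrite lecE => /andP[].
(* Adding [B^-1] to the Bessel bound [K] makes the bounds ordered at once. *)
exists B^-1, (K + B^-1); split; rewrite ?invr_gt0 ?lerDr // => f.
have ff := dnorm_ge0 (@dotmx _ d) f; split; last first.
  apply: le_trans (bessel_bound Psi f) _.
  by rewrite ler_wpM2r // lecR lerDl invr_ge0 ltW.
have [->|f0] := eqVneq f 0.
  by rewrite dot0l mulr0 sumr_ge0 // => i _; rewrite exprn_ge0.
have ff0 : 0 < '[f, f] by rewrite (dnorm_gt0 (@dotmx _ d)).
have cs := sum_CauchySchwarz (fun i => '[f, Psi i]) (fun i => '[f, Phi i]).
have ab : `|\sum_i '[f, Psi i] * Num.conj '[f, Phi i]| = '[f, f].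
  rewrite -[RHS]ger0_norm //; congr (`|_|).
  transitivity '[\sum_i '[f, Psi i] *: Phi i, f]; last by rewrite -syn'.
  rewrite dot_combl.
  by apply: eq_bigr => i _; congr (_ * _); rewrite -dotC.
rewrite ab in cs.
have [_ ub] := frB f.
have BC0 : 0 < B%:C by rewrite (ltcR 0).
have -> : (B^-1)%:C = B%:C^-1 by exact: fmorphV.
apply: (ler_invM_of_sqr BC0 ff0 _ cs ub).
by apply: sumr_ge0 => i _; rewrite exprn_ge0.
Qed.

End FrameTheory.

(** * The Laplacian and its kernel; vertices share a component when their roots agree *)

Section Laplacian.
Variables (n : nat) (e : rel 'I_n).
Hypothesis sg : simple_graph e.

Lemma laplacian_mul (K : pzRingType) (x : 'I_n -> K) i :
  \sum_j laplacian e K i j * x j = \sum_j (e i j)%:R * (x i - x j).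
Proof.
under eq_bigr do rewrite !mxE mulrBl; under [RHS]eq_bigr do rewrite mulrBr.
rewrite !sumrB; congr (_ - _); rewrite (bigD1 i) //= eqxx mulr1n.
rewrite big1 => [|j /negPf ji]; last by rewrite eq_sym ji mulr0n mul0r.
rewrite addr0 -mulr_suml; congr (_ * _).
by rewrite -natr_sum -sum1dep_card big_mkcond; congr (_%:R).
Qed.

Lemma laplacian_sym (K : pzRingType) i j : laplacian e K i j = laplacian e K j i.
Proof. by rewrite !mxE sg.1 eq_sym; case: eqVneq => [->|]. Qed.

Lemma connect_sym_graph : connect_sym e.
Proof. exact/sym_connect_sym/sg.1. Qed.

Lemma root_edge i j : e i j -> fingraph.root e i = fingraph.root e j.
Proof. by move=> /connect1 /(fingraph.rootP connect_sym_graph). Qed.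

(** The quadratic form of the Laplacian at [x] vanishes; twice it is the sum of [|x k - x l|^2] over
    ordered pairs of adjacent vertices, so [x] is constant along edges. *)
Lemma laplacian_ker (C : numClosedFieldType) (x : 'I_n -> C) :
  (forall i, \sum_j laplacian e C i j * x j = 0) ->
  forall i j, fingraph.root e i = fingraph.root e j -> x i = x j.
Proof.
move=> Lx0.
have edge i j : e i j -> x i = x j.
  (* The sum of [F] is the quadratic form, and [F k l + F l k] is the squared modulus of the
     difference on an edge. *)
  pose F k l : C := (e k l)%:R * (Num.conj (x k) * (x k - x l)).
  have F0 : \sum_k \sum_l F k l = 0.
    apply: big1 => k _.
    transitivity (Num.conj (x k) * \sum_l laplacian e C k l * x l); last first.
      by rewrite Lx0 mulr0.
    rewrite laplacian_mul mulr_sumr.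
    by apply: eq_bigr => l _; rewrite /F mulrCA.
  have : \sum_i \sum_j (e i j)%:R * `|x i - x j| ^+ 2 = 0.
    transitivity (\sum_k \sum_l F k l + \sum_k \sum_l F l k); last first.
      by rewrite [X in _ + X]exchange_big F0 addr0.
    rewrite -big_split; apply: eq_bigr => k _.
    rewrite -big_split; apply: eq_bigr => l _ /=.
    rewrite /F [e l k]sg.1 -mulrDr; congr (_ * _).
    by rewrite normCK rmorphB -[x l - x k]opprB mulrN -mulrBl mulrC.
  have nn k l : 0 <= (e k l)%:R * `|x k - x l| ^+ 2.
    by rewrite mulr_ge0 ?ler0n ?exprn_ge0.
  move=> /eqP; rewrite psumr_eq0 => [|k _]; last exact: sumr_ge0.
  move=> /allP/(_ i (mem_index_enum _)); rewrite psumr_eq0 //.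
  move=> /allP/(_ j (mem_index_enum _)) /= H2 eij; move: H2.
  by rewrite eij mul1r sqrf_eq0 normr_eq0 subr_eq0 => /eqP.
move=> i j /(fingraph.rootP connect_sym_graph) ij.
have cl : closed e [pred z | x z == x i] by move=> k l /edge kl; rewrite !inE kl.
by have := closed_connect cl ij; rewrite !inE eqxx => /esym/eqP.
Qed.

Definition component_size i := #|[set j | fingraph.root e j == fingraph.root e i]%SET|.

Lemma component_size_gt0 i : (0 < component_size i)%N.
Proof. by apply/card_gt0P; exists i; rewrite inE. Qed.

End Laplacian.

(** * Cross-Gramians of the duals of a graph frame *)

Section GraphFrameTheory.
Variables (R : realType) (n d : nat) (e : rel 'I_n).
Variable Phi : {ffun 'I_n -> 'rV[R[i]]_d}.
Hypotheses (sg : simple_graph e) (gf : graph_frame e Phi).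

Lemma graph_frame_dot i j : '[Phi i, Phi j] = laplacian e R[i] i j.
Proof. by rewrite laplacian_sym // -gf.2 mxE. Qed.

(** The indicator of a component is in the kernel of the Laplacian, which is the Gramian, so the sum
    is orthogonal to each of its terms. *)
Lemma sum_component_eq0 i : \sum_(j | fingraph.root e j == fingraph.root e i) Phi j = 0.
Proof.
apply/eqP; rewrite -(dnorm_eq0 (@dotmx _ d)) /= dot_suml big1 // => j _.
rewrite dot_sumr big_mkcond /=.
pose x k : R[i] := (fingraph.root e k == fingraph.root e i)%:R.
transitivity (\sum_k laplacian e R[i] j k * x k).
  apply: eq_bigr => k _; rewrite /x graph_frame_dot.
  by case: ifP; rewrite ?mulr1 ?mulr0.
rewrite laplacian_mul big1 // => k _; rewrite /x.
have [jk|] := boolP (e j k); last by rewrite mul0r.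
by rewrite (root_edge sg jk) subrr mulr0.
Qed.

Lemma sum_component_dot v i : \sum_(j | fingraph.root e j == fingraph.root e i) '[v, Phi j] = 0.
Proof. by rewrite -dot_sumr sum_component_eq0 dotC dot0l rmorph0. Qed.

Section Dual.
Variable Psi : {ffun 'I_n -> 'rV[R[i]]_d}.
Hypothesis syn : forall f, f = \sum_i '[f, Phi i] *: Psi i.

(** Reconstructing [Phi i] from [Psi] and pairing with [Phi l] gives [L M = L] for the Laplacian
    [L], so the columns of [I - M] are in its kernel. *)
Lemma dual_const_component i j l : fingraph.root e i = fingraph.root e j ->
  (i == l)%:R - '[Psi i, Phi l] = (j == l)%:R - '[Psi j, Phi l].
Proof.
apply: (laplacian_ker sg (x := fun i => (i == l)%:R - '[Psi i, Phi l])) => {i j} i.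
under eq_bigr do rewrite mulrBr.
rewrite sumrB (bigD1 l) //= eqxx mulr1 big1 => [|j /negPf->]; last by rewrite mulr0.
under eq_bigr do rewrite -graph_frame_dot.
by rewrite -dot_combl -syn graph_frame_dot addr0 subrr.
Qed.

Lemma dual_trace_component i :
  \sum_(j | fingraph.root e j == fingraph.root e i) '[Psi j, Phi j] = (component_size e i)%:R - 1.
Proof.
apply/esym/eqP; rewrite subr_eq addrC -subr_eq; apply/eqP.
have -> : (component_size e i)%:R = \sum_(j | fingraph.root e j == fingraph.root e i) 1 :> R[i].
  by rewrite sumr_const /component_size cardsE.
rewrite -sumrB.
(* Each diagonal entry of [I - M] equals the entry of row [i] in its column, and row [i] of [M] sums
   to 0 over the component. *)
transitivity (\sum_(j | fingraph.root e j == fingraph.root e i) ((i == j)%:R - '[Psi i, Phi j])).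
  by apply: eq_bigr => j /eqP ij; rewrite -(dual_const_component j ij) eqxx.
rewrite sumrB sum_component_dot subr0 (bigD1 i) //= eqxx big1 ?addr0 // => j.
by case/andP=> _; rewrite eq_sym => /negPf->.
Qed.

Lemma dual_rho1_ge i : 1 - (component_size e i)%:R^-1 <= (rho 1 Phi Psi)%:C.
Proof.
have m0 : 0 < (component_size e i)%:R :> R[i] by rewrite ltr0n component_size_gt0.
rewrite -(ler_pM2l m0) mulrBr mulr1 divff ?gt_eqF //.
have p0 : 0 <= (component_size e i)%:R - 1 :> R[i].
  by rewrite subr_ge0 ler1n component_size_gt0.
rewrite -(ger0_norm p0) -dual_trace_component.
apply: le_trans (ler_norm_sum _ _ _) _.
have -> : (component_size e i)%:R * (rho 1 Phi Psi)%:C =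
    \sum_(j | fingraph.root e j == fingraph.root e i) (rho 1 Phi Psi)%:C.
  by rewrite sumr_const mulr_natl /component_size cardsE.
by apply: ler_sum => j _; apply: norm_dot_le_rho1.
Qed.

Lemma dual_rho2_ge1 i j : i != j -> fingraph.root e i = fingraph.root e j -> 1 <= (rho 2 Phi Psi)%:C.
Proof.
move=> ij rij; rewrite -[1 in X in X <= _]normr1.
apply: (rho_ge (L := [set i; j]%SET)); first by rewrite cards2 ij.
have D l : '[Psi i - Psi j, Phi l] = (i == l)%:R - (j == l)%:R.
  by rewrite dotBl; apply: subr_swap; apply: dual_const_component.
apply/error_eigenP; exists (Psi i - Psi j).
  rewrite /error_op big_setU1 ?inE //= big_set1 !D !eqxx [j == i]eq_sym (negPf ij).
  by rewrite subr0 sub0r !scale1r scaleN1r.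
apply/eqP => H; have := D i; rewrite H dot0l eqxx [j == i]eq_sym (negPf ij) subr0.
by move/eqP; rewrite eq_sym oner_eq0.
Qed.

End Dual.

(** Here [I - M] is also Hermitian, hence constant on each block given by two components; the sum of
    a row over a component then determines the constant. *)
Lemma canonical_dual_dot i j : '[canonical_dual Phi i, Phi j] =
  (i == j)%:R - (fingraph.root e i == fingraph.root e j)%:R / (component_size e j)%:R.
Proof.
have [frPhi _] := gf.
pose Q i j : R[i] := (i == j)%:R - '[canonical_dual Phi i, Phi j].
have Ql k k' l : fingraph.root e k = fingraph.root e k' -> Q k l = Q k' l.
  by apply: dual_const_component => f; apply: canonical_dual_synthesis.
have QC k l : Q k l = Num.conj (Q l k).
  by rewrite /Q rmorphB rmorph_nat eq_sym canonical_dual_dotC.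
have Qr k l l' : fingraph.root e l = fingraph.root e l' -> Q k l = Q k l'.
  by move=> ll; rewrite QC (Ql _ _ _ ll) -QC.
have m0 : (component_size e j)%:R != 0 :> R[i].
  by rewrite pnatr_eq0 -lt0n component_size_gt0.
suff : (component_size e j)%:R * Q i j = (fingraph.root e i == fingraph.root e j)%:R.
  by move=> <-; rewrite mulrC mulKf // /Q subKr.
transitivity (\sum_(l | fingraph.root e l == fingraph.root e j) Q i l).
  rewrite (eq_bigr (fun=> Q i j)) => [|l /eqP lj]; last exact: Qr.
  by rewrite sumr_const mulr_natl /component_size cardsE.
rewrite sumrB sum_component_dot subr0 big_mkcond (bigD1 i) //= eqxx.
rewrite big1 => [|l]; last by rewrite eq_sym => /negPf->; case: ifP.
by rewrite addr0; case: ifP.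
Qed.

(** * The shifted dual and its erasure radii *)

Definition shifted_dual c i0 : {ffun 'I_n -> 'rV[R[i]]_d} :=
  [ffun l => canonical_dual Phi l +
             (fingraph.root e l == fingraph.root e c)%:R *: canonical_dual Phi i0].

(** The shift adds a fixed vector times the sum of [<f, Phi l>] over the component of [c], which is
    0. *)
Lemma shifted_dual_synthesis c i0 f :
  f = \sum_l '[f, Phi l] *: shifted_dual c i0 l.
Proof.
under eq_bigr do rewrite ffunE scalerDr scalerA.
rewrite big_split /= -canonical_dual_synthesis; last exact: gf.1.
rewrite -scaler_suml (_ : \sum_l _ = 0) ?scale0r ?addr0 //.
rewrite -[RHS](sum_component_dot f c) [RHS]big_mkcond; apply: eq_bigr => l _.
by case: ifP; rewrite ?mulr1 ?mulr0.
Qed.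

Lemma shifted_dual_dot c i0 l j : '[shifted_dual c i0 l, Phi j] =
  (l == j)%:R - (fingraph.root e l == fingraph.root e j)%:R / (component_size e j)%:R
  + (fingraph.root e l == fingraph.root e c)%:R * '[canonical_dual Phi i0, Phi j].
Proof. by rewrite ffunE dotDl dotZl canonical_dual_dot. Qed.

Lemma canonical_dual_dot_eq0 i j :
  fingraph.root e i != fingraph.root e j -> '[canonical_dual Phi i, Phi j] = 0.
Proof.
move=> ij; rewrite canonical_dual_dot (negPf ij) mul0r subr0.
by case: (eqVneq i j) ij => [->|//]; rewrite eqxx.
Qed.

Lemma inv_component_size_itv i :
  let t : R[i] := (component_size e i)%:R^-1 in 0 <= t <= 1.
Proof.
have m0 := component_size_gt0 e i.
by rewrite /= invr_ge0 ler0n invf_le1 ?ltr0n // ler1n.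
Qed.

Section Shifted.
Variables c i0 : 'I_n.
Hypothesis ci0 : fingraph.root e i0 != fingraph.root e c.

Lemma shifted_dual_dot_same l j : fingraph.root e l = fingraph.root e j ->
  '[shifted_dual c i0 l, Phi j] = (l == j)%:R - (component_size e j)%:R^-1.
Proof.
move=> lj; rewrite shifted_dual_dot lj eqxx mul1r.
case: (eqVneq (fingraph.root e j) (fingraph.root e c)) => [jc|_]; last by rewrite mul0r addr0.
by rewrite canonical_dual_dot_eq0 ?jc // mulr0 addr0.
Qed.

Lemma shifted_dual_dot_diag l :
  '[shifted_dual c i0 l, Phi l] = 1 - (component_size e l)%:R^-1.
Proof. by rewrite shifted_dual_dot_same // eqxx. Qed.

(** Only rows in the component of [c] are altered, and one of [l], [j] is outside it. *)
Lemma shifted_dual_dot_triangular l j : fingraph.root e l != fingraph.root e j ->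
  '[shifted_dual c i0 l, Phi j] = 0 \/ '[shifted_dual c i0 j, Phi l] = 0.
Proof.
move=> lj; have [lj' jl'] : l != j /\ j != l.
  by rewrite eq_sym; split; apply: contraNneq lj => ->.
have cross k k' : k != k' -> fingraph.root e k != fingraph.root e k' ->
    fingraph.root e k != fingraph.root e c -> '[shifted_dual c i0 k, Phi k'] = 0.
  move=> /negPf kk' /negPf rkk' /negPf kc; rewrite shifted_dual_dot kk' rkk' kc.
  by move: '[_, _] => z; rewrite !mul0r subr0 addr0.
have [lc|lc] := eqVneq (fingraph.root e l) (fingraph.root e c); last by left; apply: cross.
by right; apply: cross; rewrite // -?lc eq_sym.
Qed.

(** The bound [r] will be the radius of an arbitrary dual, so the optimal value is never
    computed. *)
Lemma shifted_dual_rho1_le (r : R) : 0 <= r ->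
  (forall i, 1 - (component_size e i)%:R^-1 <= r%:C) ->
  rho 1 Phi (shifted_dual c i0) <= r.
Proof.
move=> r0 H; apply: rho1_le => // i; rewrite shifted_dual_dot_diag ger0_norm //.
by rewrite subr_ge0; case/andP: (inv_component_size_itv i).
Qed.

(** A nonzero eigenvalue is one of a 2 x 2 block of [M]: of the form [I - t J] inside a component,
    triangular with diagonal in [[0, 1]] across two. *)
Lemma shifted_dual_rho2_le1 : rho 2 Phi (shifted_dual c i0) <= 1.
Proof.
apply: rho_le => // L a /eqP/cards2P[i [j [ij ->]]] /error_eigenP[f Ef f0].
have [->|a0] := eqVneq a 0; first by rewrite normr0 (lecR 0).
have M l : '[f, Phi i] * '[shifted_dual c i0 i, Phi l] +
           '[f, Phi j] * '[shifted_dual c i0 j, Phi l] = a * '[f, Phi l].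
  by rewrite -(error_op_dot l Ef) big_setU1 ?inE //= big_set1.
have xy : ('[f, Phi i] != 0) || ('[f, Phi j] != 0).
  have [k /set2P[->|->] fk] := error_op_coef_neq0 Ef f0 a0; apply/orP.
    by left.
  by right.
have diag_le1 k : `|1 - (component_size e k)%:R^-1| <= 1 :> R[i].
  have /andP[t0 t1] := inv_component_size_itv k.
  by rewrite ger0_norm ?subr_ge0 // lerBlDr lerDl.
have := M j; have := M i; rewrite !shifted_dual_dot_diag.
have [rij|rij] := eqVneq (fingraph.root e i) (fingraph.root e j).
  rewrite !shifted_dual_dot_same // [j == i]eq_sym (negPf ij) !sub0r.
  have -> : component_size e i = component_size e j by rewrite /component_size rij.
  have /andP[t0 t1] := inv_component_size_itv j.
  move=> Ei Ej; have [->|->] := eigenvalue_rank1_2x2 Ei Ej xy; first by rewrite normr1.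
  (* As [0 <= t <= 1], the triangle inequality bounds [|(1 - t) - t|] by [(1 - t) + t = 1]. *)
  apply: le_trans (ler_normB _ _) _.
  by rewrite !ger0_norm ?subr_ge0 // subrK.
move=> Ei Ej.
by have [->|->] := eigenvalue_triangular_2x2 Ei Ej xy (shifted_dual_dot_triangular rij).
Qed.

Lemma shifted_dual_spectrally_optimal2 j : i0 != j -> fingraph.root e i0 = fingraph.root e j ->
  spectrally_optimal2 Phi (shifted_dual c i0).
Proof.
move=> i0j ri0j.
have dual : is_dual_frame Phi (shifted_dual c i0).
  by apply: is_dual_frame_synthesis; [exact: gf.1 | exact: shifted_dual_synthesis].
split; [split=> //|]; split; try by exists (shifted_dual c i0).
- move=> _ [Psi [_ syn] <-]; apply: shifted_dual_rho1_le => [|i]; first exact: rho_ge0.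
  by apply: dual_rho1_ge => f; case: (syn f).
- move=> _ [Psi [_ syn] <-]; apply: le_trans shifted_dual_rho2_le1 _.
  have syn1 f : f = \sum_l '[f, Phi l] *: Psi l by case: (syn f).
  by have := dual_rho2_ge1 syn1 i0j ri0j; rewrite (lecR 1).
Qed.

End Shifted.

(** * Choice of the shift vector and of the component *)

Lemma shifted_dual_neq c i0 : Phi i0 != 0 -> shifted_dual c i0 != canonical_dual Phi.
Proof.
apply: contraNneq => /ffunP/(_ c).
rewrite ffunE eqxx scale1r -[RHS]addr0 => /addrI h0.
(* If the shift vector were 0, so would be its image [Phi i0] under [S]. *)
by rewrite -(frame_op_canonical_dual i0 gf.1) h0 frame_opE mul0mx.
Qed.

(** In positive dimension some frame vector is nonzero; its squared norm is the degree of its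
    vertex, which thus has a neighbour. *)
Lemma graph_frame_neighbor : (0 < d)%N ->
  exists i j, [/\ Phi i != 0, i != j & fingraph.root e i = fingraph.root e j].
Proof.
move=> d0; have [i Phi0] : exists i, Phi i != 0.
  apply/existsP; apply: contraTT d0; rewrite negb_exists => /forallP Phi0.
  have f0 (f : 'rV[R[i]]_d) : f = 0.
    apply: (is_frame_dot_eq0 gf.1) => i; have := Phi0 i; rewrite negbK => /eqP->.
    by rewrite dotC dot0l rmorph0.
  rewrite -eqn0Ngt; have /rowP := f0 (const_mx 1).
  case: d => // d' /(_ ord0)/eqP; by rewrite !mxE oner_eq0.
have [j eij] : exists j, e i j.
  apply/existsP; apply: contraNT Phi0; rewrite negb_exists => /forallP e0.
  rewrite -(dnorm_eq0 (@dotmx _ d)) /= graph_frame_dot !mxE eqxx mulr1n sg.2 subr0.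
  by rewrite cardsE eq_card0 // => j; apply/negbTE; exact: e0.
exists i, j; split=> //; last exact: root_edge.
by apply: contraTneq eij => <-; rewrite sg.2.
Qed.

End GraphFrameTheory.

(** [n_comp] counts roots, and of two distinct roots at least one is not that of [i]. *)
Lemma other_component n (e : rel 'I_n) i : simple_graph e ->
  (1 < num_components e)%N -> exists c, fingraph.root e i != fingraph.root e c.
Proof.
move=> sg; rewrite /num_components => /card_gt1P.
move=> [x [y [/andP[/eqP rx _] /andP[/eqP ry _] xy]]].
have [ix|] := eqVneq (fingraph.root e i) (fingraph.root e x); last by exists x.
by exists y; rewrite ix rx ry.
Qed.

End GraphFrames.

Theorem corollary4p2 (R : realType) (n k : nat) (e : rel 'I_n)
    (Phi : {ffun 'I_n -> 'rV[R[i]]_(n - k)}) :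
  simple_graph e ->
  num_components e = k ->
  1 < k ->
  0 < n - k ->
  graph_frame e Phi ->
  exists Psi : {ffun 'I_n -> 'rV[R[i]]_(n - k)},
    is_alternate_dual Phi Psi /\ spectrally_optimal2 Phi Psi.
Proof.
move=> sg ek k1 d0 gf.
(* [i0] serves twice: [Phi i0 != 0] makes the shift nontrivial, and the pair [i0], [j] yields the
   lower bound 1 for two erasures. *)
have [i0 [j [Phi0 i0j ri0j]]] := graph_frame_neighbor sg gf d0.
have [c ci0] : exists c, fingraph.root e i0 != fingraph.root e c by apply: other_component; rewrite ?ek.
have opt := shifted_dual_spectrally_optimal2 sg gf ci0 i0j ri0j.
exists (shifted_dual e Phi c i0); split=> //; split; first exact: opt.1.1.
exact: shifted_dual_neq.
Qed.
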